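(* Let $X_d$ be an RCB-space and let $(g_i)_{i=1}^\infty$ (with $g_i\in X^*$) be an $X_d$-frame for $X$. Let $U:X\to X_d$, $Uf=(g_i(f))_{i=1}^\infty$, and let $U^{-1}:\mathcal{R}(U)\to X$ denote its inverse on its range. Then the following holds. (a) If $(g_i)_{i=1}^\infty$ has a dual $X_d^*$-frame, then all the dual $X_d^*$-frames of $(g_i)_{i=1}^\infty$ are precisely the sequences $(L\delta_i)_{i=1}^\infty$, where $L:X_d\to X$ is a bounded linear extension of $U^{-1}$. (b) If $(g_i)_{i=1}^\infty$ has an s-pseudo-dual, then all the s-pseudo-duals of $(g_i)_{i=1}^\infty$ are precisely the sequences $(L\delta_i)_{i=1}^\infty$, where the operator $L:\mathcal{D}(L)\to X$ is such that $\mathcal{D}(L)$ is a linear subset of $X_d$ containing $\mathrm{span}\{\delta_i\}$ and $\mathcal{R}(U)$, $$L\Big(\sum_{i=1}^n g_i(f)\delta_i\Big)\to L\Big(\sum_{i=1}^\infty g_i(f)\delta_i\Big)\quad\text{as } n\to\infty,\ \text{for every } f\in X,$$ and $L$ is a left inverse of $U$.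
   Context: $X$ is an infinite-dimensional separable Banach space with dual $X^*$. ''Operator'' means linear mapping; $\mathcal{D}(V)$ and $\mathcal{R}(V)$ are the domain and range of an operator $V$; $\mathrm{span}$ denotes the set of all finite linear combinations. $X_d$ is a Banach sequence space (a Banach space of scalar sequences). It is a CB-space if the canonical vectors form a Schauder basis $(\delta_i)_{i=1}^\infty$ of $X_d$ (so $(c_i)=\sum c_i\delta_i$ for all $(c_i)\in X_d$); an RCB-space if it is a reflexive CB-space. For a CB-space $X_d$, the dual $X_d^*$ is identified with the sequence space $\{(V\delta_i)_{i=1}^\infty: V\in X_d^*\}$ with norm $\|(V\delta_i)\|=\|V\|_{X_d^*}$. A sequence $(g_i)_{i=1}^\infty$ in $X^*$ is an $X_d$-frame for $X$ if $(g_i(f))_{i=1}^\infty\in X_d$ for all $f\in X$ and there are constants $A,B>0$ with $A\|f\|_X\le\|(g_i(f))_{i=1}^\infty\|_{X_d}\le B\|f\|_X$ for all $f\in X$. A sequence $(f_i)_{i=1}^\infty$ in $X$ is an $X_d^*$-frame for $X^*$ (the $f_i$ being viewed as elements of $X^{**}$) if $(g(f_i))_{i=1}^\infty\in X_d^*$ for all $g\in X^*$ and there are constants $A,B>0$ with $A\|g\|_{X^*}\le\|(g(f_i))_{i=1}^\infty\|_{X_d^*}\le B\|g\|_{X^*}$ for all $g\in X^*$. Given an $X_d$-frame $(g_i)$ for $X$, a sequence $(f_i)_{i=1}^\infty$ in $X$ is called an s-pseudo-dual (synthesis-pseudo-dual) of $(g_i)$ if $f=\sum_{i=1}^\infty g_i(f)f_i$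 (norm convergence) for all $f\in X$; it is called a dual $X_d^*$-frame of $(g_i)$ if, in addition, it is an $X_d^*$-frame for $X^*$. *)

(* Defs.v *)
From HB Require Import structures.
From mathcomp Require Import all_boot all_order all_algebra.
From mathcomp Require Import complex boolp classical_sets functions cardinality reals.
From mathcomp Require Import topology normedtype sequences.

Set Implicit Arguments.
Unset Strict Implicit.
Unset Printing Implicit Defensive.

Import Order.TTheory GRing.Theory Num.Theory.
Import numFieldNormedType.Exports.

Local Open Scope classical_set_scope.
Local Open Scope ring_scope.

(* Banach spaces are real or complex. In [R[i]], [x <= y] means that [y - x]
   is a nonnegative real, and norms take values in the scalar field; hence a
   positive constant [0 < A] is a positive real number in both cases. *)
Variant scalar_kind := RealScalars | ComplexScalars.

Definition scalar_field (R : realType) (k : scalar_kind) : numFieldType :=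
  match k with RealScalars => R | ComplexScalars => R[i] end.

Section Dual.
Variables (K : numFieldType) (V : normedModType K).

Definition dual_pred : {pred V -> K^o} :=
  fun f => `[< linear f /\ continuous f >].

Lemma dual_pred_submod_closed : submod_closed dual_pred.
Proof.
split=> [|a f g /asboolP[fl fc] /asboolP[gl gc]]; apply/asboolP; split.
- by move=> a x y /=; rewrite scaler0 addr0.
- by move=> x; exact: cvg_cst.
- move=> b x y /=; rewrite fctE.
  rewrite (_ : (a *: f) = fun x => a *: f x)// fl gl.
  by rewrite !scalerDr !scalerA mulrC addrACA.
- move=> x; apply: cvgD; last exact: gc.
  by apply: cvgZl_tmp; exact: fc.
Qed.

HB.instance Definition _ :=
  GRing.isSubmodClosed.Build K (V -> K^o) dual_pred dual_pred_submod_closed.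

Record dual := Dual {dual_fun :> V -> K^o; dual_funP : dual_fun \in dual_pred}.

HB.instance Definition _ := [isSub for dual_fun].
HB.instance Definition _ := [Choice of dual by <:].
HB.instance Definition _ := [SubChoice_isSubLmodule of dual by <:].

Definition dual_norm (phi : dual) : K :=
  supremum 0 [set `|phi x| | x in [set x : V | `|x| <= 1]].

End Dual.

Section BanachSpaces.
Variable K : numFieldType.

Definition finite_dimensional (V : lmodType K) : Prop :=
  exists (n : nat) (e : 'I_n -> V),
    forall x : V, exists c : 'I_n -> K, x = \sum_(i < n) c i *: e i.

Definition separable (T : topologicalType) : Prop :=
  exists D : set T, countable D /\ dense D.

(* [Phi] ranges over the bounded linear functionals on the normed space
   [dual V], i.e. over the bidual of [V]. *)
Definition reflexive_space (V : normedModType K) : Prop :=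
  forall Phi : {linear dual V -> K^o},
    (exists M : K, forall phi : dual V, `|Phi phi| <= M * dual_norm phi) ->
    exists x : V, forall phi : dual V, Phi phi = phi x.

Definition bounded_operator (V W : normedModType K) (T : {linear V -> W}) :
    Prop :=
  exists M : K, forall x : V, `|T x| <= M * `|x|.

Definition schauder_basis (V : normedModType K) (e : nat -> V) : Prop :=
  forall x : V, exists! a : nat -> K,
    series (fun i => a i *: e i) @ \oo --> x.

Definition linear_span (V : lmodType K) (e : nat -> V) : set V :=
  [set x | exists (n : nat) (c : nat -> K), x = \sum_(i < n) c i *: e i].

(* A linear mapping defined on a linear subset [op_dom] of [V]; the values of
   [op_fun] outside [op_dom] are irrelevant. *)
Record partial_operator (V W : lmodType K) := PartialOperator {
  op_dom : set V;
  op_fun :> V -> W;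
  op_dom0 : op_dom 0;
  op_dom_linear : forall (a : K) (x y : V),
    op_dom x -> op_dom y -> op_dom (a *: x + y);
  op_fun_linear : forall (a : K) (x y : V),
    op_dom x -> op_dom y -> op_fun (a *: x + y) = a *: op_fun x + op_fun y
}.

(* A Banach space whose elements are scalar sequences: a Banach space with an
   injective linear map [entries] into the space of all sequences. Sequences
   are indexed from 0. *)
Record seq_space := SeqSpace {
  seq_carrier :> completeNormedModType K;
  entries : {linear seq_carrier -> (nat -> K^o)};
  entries_inj : injective entries
}.
Arguments entries {s}.

(* Continuity of the coordinates is not assumed, so [delta_schauder] alone
   would not identify the basis coefficients of [c] with its entries. *)
Record cb_space := CBSpace {
  cb_seq_space :> seq_space;
  delta : nat -> cb_seq_space;
  delta_entries : forall i, entries (delta i) = (fun j => (j == i)%:R);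
  delta_schauder : schauder_basis delta;
  delta_expansion : forall c : cb_seq_space,
    series (fun i => entries c i *: delta i) @ \oo --> c
}.

Record rcb_space := RCBSpace {
  rcb_cb_space :> cb_space;
  rcb_reflexive : reflexive_space rcb_cb_space
}.

Definition Xd_frame (Xd : seq_space) (X : normedModType K)
    (g : nat -> dual X) : Prop :=
  (forall f : X, exists c : Xd, entries c = (fun i => g i f)) /\
  exists A B : K, [/\ 0 < A, 0 < B &
    forall (f : X) (c : Xd), entries c = (fun i => g i f) ->
      A * `|f| <= `|c| <= B * `|f|].

(* The sequence space Xd^* consists of the sequences [(V delta_i)_i], normed by
   the dual norm of [V]; [V] is determined by its sequence. *)
Definition dual_Xd_frame (Xd : cb_space) (X : normedModType K)
    (f_ : nat -> X) : Prop :=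
  (forall g : dual X, exists V : dual Xd, forall i, V (delta Xd i) = g (f_ i)) /\
  exists A B : K, [/\ 0 < A, 0 < B &
    forall (g : dual X) (V : dual Xd), (forall i, V (delta Xd i) = g (f_ i)) ->
      A * dual_norm g <= dual_norm V <= B * dual_norm g].

Definition s_pseudo_dual (X : normedModType K) (g : nat -> dual X)
    (f_ : nat -> X) : Prop :=
  forall f : X, series (fun i => g i f *: f_ i) @ \oo --> f.

Definition dual_frame_of (Xd : cb_space) (X : normedModType K)
    (g : nat -> dual X) (f_ : nat -> X) : Prop :=
  s_pseudo_dual g f_ /\ dual_Xd_frame Xd f_.

End BanachSpaces.

Arguments entries {K s}.
Arguments entries_inj {K s}.

(* Main.v *)
Require Import Defs.
From HB Require Import structures.
From mathcomp Require Import all_boot all_order all_algebra.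
From mathcomp Require Import complex boolp classical_sets functions cardinality.
From mathcomp Require Import reals.
From mathcomp Require Import topology normedtype sequences.

Set Implicit Arguments.
Unset Strict Implicit.
Unset Printing Implicit Defensive.

Import Order.TTheory GRing.Theory Num.Theory.
Import numFieldNormedType.Exports.

Local Open Scope classical_set_scope.
Local Open Scope ring_scope.

(** A dual frame and an s-pseudo-dual of [(g_i)] are both synthesis systems:
    [f = sum_i g_i(f) f_i] says that [c |-> sum_i c_i f_i] is a left inverse of
    the analysis operator [U]. So the operator [L] attached to [(f_i)] has to be
    [c |-> sum_i c_i f_i], and [(f_i)] is recovered as [(L delta_i)] because
    the synthesis series of [delta_i] is constantly [f_i] from rank [i + 1] on
    ([cvg_series_delta]).

    For s-pseudo-duals no bound is available, so [L] is only defined where the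
    series converges ([synthesis_partial_operator]). Conversely, a partial
    operator is linear on finite sums ([partial_operator_series]), which turns
    the continuity along the partial sums of [U f] into the expansion of [f].

    For dual [Xd^*]-frames the point is that [L] is everywhere defined and
    bounded. The upper frame bound controls the scalars
    [phi (sum c_i f_i) = V (sum c_i delta_i)], for [phi] in the unit ball of
    [X^*] and [V] in [Xd^*] with coordinates [phi f_i]. A functional [phi] of
    norm at most one that attains the norm of [sum c_i f_i] turns this into
    [|sum c_i f_i| <= B |sum c_i delta_i|] for all finite sums
    ([dual_Xd_frame_combination_le]); since [(delta_i)] is a basis and [X] is
    complete, the series converges and [L] has norm at most [B]
    ([synthesis_operator]). Conversely, if [L] is bounded and [L U = 1], the
    functional with coordinates [phi (L delta_i)] is [phi o L], and
    [|phi o L| <= |L| |phi|], [|phi| = |phi o L o U| <= |U| |phi o L|]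
    ([dual_Xd_frame_operator]).

    The norm-attaining functional comes from the Hahn-Banach theorem, proved
    here by taking a minimal sublinear functional below the norm: minimality
    forces linearity ([hahn_banach]). The real and the complex case share this
    proof, and the complex functional is rebuilt from its real part
    ([norming_functional_complex]). *)

(** * The Hahn-Banach theorem through minimal sublinear functionals *)

Section HahnBanach.
(* Functionals are linear over the reals only, on a module over a ring [K] that
   receives the reals through [iota]: [iota] is the identity when [K] is [R]
   and the inclusion when [K] is [R[i]], so that one proof serves both. *)
Variables (R : realType) (K : nzRingType) (iota : {rmorphism R -> K}).
Variable V : lmodType K.
Implicit Types (p q : V -> R) (x y z : V).

Definition sublinear p :=
  (forall x y, p (x + y) <= p x + p y) /\
  (forall t x, 0 <= t -> p (iota t *: x) = t * p x).

Lemma sublinear0 p : sublinear p -> p 0 = 0.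
Proof. by case=> _ /(_ 0 0 (lexx 0)); rewrite rmorph0 scale0r mul0r. Qed.

Lemma sublinear_oppr p x : sublinear p -> - p (- x) <= p x.
Proof.
move=> sp; have [pD _] := sp.
by rewrite lerNl -subr_ge0 opprK -(sublinear0 sp) -(addNr x) pD.
Qed.

(** Both infima needed below, that of a chain and that defining [slide], are
    infima of families that are subadditive and positively homogeneous only up
    to changing the index. *)
Lemma inf_sublinear (I : Type) (D : set I) (F : I -> V -> R) :
  D !=set0 ->
  (forall x, has_lbound [set F i x | i in D]) ->
  (forall i, D i -> F i 0 = 0) ->
  (forall i j x y, D i -> D j ->
     exists2 l, D l & F l (x + y) <= F i x + F j y) ->
  (forall i t x, D i -> 0 < t ->
     exists2 l, D l & F l (iota t *: x) <= t * F i x) ->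
  sublinear (fun x => inf [set F i x | i in D]).
Proof.
move=> [i0 Di0] lbF F0 FD FZ.
set q := fun x => _.
have qF i x : D i -> q x <= F i x.
  by move=> Di; apply: ge_inf => //; exists i.
have lbq x b : (forall i, D i -> b <= F i x) -> b <= q x.
  move=> bF; apply: lb_le_inf; first by exists (F i0 x), i0.
  by move=> _ [i Di <-]; exact: bF.
have q0 : q 0 = 0.
  apply/eqP; rewrite eq_le -{1}(F0 _ Di0) (qF _ _ Di0)/=.
  by apply: (lbq) => i Di; rewrite F0.
have qZ t x : 0 < t -> q (iota t *: x) <= t * q x.
  move=> t0; rewrite -ler_pdivrMl//; apply: (lbq) => i Di.
  have [l Dl ltx] := FZ i t x Di t0.
  by rewrite ler_pdivrMl// (le_trans (qF _ _ Dl)).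
split=> [x y|t x].
  rewrite -lerBlDr; apply: (lbq) => i Di; rewrite lerBlDr -lerBlDl.
  apply: (lbq) => j Dj; rewrite lerBlDl.
  by have [l Dl /(le_trans (qF _ _ Dl))] := FD i j x y Di Dj.
rewrite le_eqVlt => /predU1P[<-|t0]; first by rewrite rmorph0 scale0r mul0r q0.
apply/eqP; rewrite eq_le qZ//= -ler_pdivlMl//.
have := qZ t^-1 (iota t *: x); rewrite invr_gt0 => /(_ t0).
by rewrite scalerA -rmorphM mulVf ?gt_eqF// rmorph1 scale1r.
Qed.

(** The largest sublinear functional below [p] whose value at [- y] is at most
    [- p y]; such a functional equals [p] at [y] and is additive along [y]. *)
Definition slide p y x : R :=
  inf [set p (x + iota t *: y) - t * p y | t in [set t | 0 <= t]].

Lemma slide_lbound p y x : sublinear p ->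
  lbound [set p (x + iota t *: y) - t * p y | t in [set t | 0 <= t]]
    (- p (- x)).
Proof.
move=> [pD pZ] _ [t /= t0 <-]; rewrite -pZ// lerBrDr addrC -lerBrDr opprK.
by rewrite -{1}(addrK x (iota t *: y)) (addrC x) pD.
Qed.

Lemma slide_le p y x t : sublinear p -> 0 <= t ->
  slide p y x <= p (x + iota t *: y) - t * p y.
Proof.
move=> sp t0; apply: ge_inf; first by exists (- p (- x)); exact: slide_lbound.
by exists t.
Qed.

Lemma slide_sublinear p y : sublinear p -> sublinear (slide p y).
Proof.
move=> sp; have [pD pZ] := sp; apply: inf_sublinear.
- by exists 0 => /=.
- by move=> x; exists (- p (- x)); exact: slide_lbound.
- by move=> t /= t0; rewrite add0r pZ// subrr.
- move=> s t x z /= s0 t0; exists (s + t); first by rewrite /= addr_ge0.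
  rewrite rmorphD scalerDl addrACA mulrDl opprD [leRHS]addrACA lerD2r.
  exact: pD.
- move=> s t x /= s0 t0; exists (t * s); first by rewrite /= mulr_ge0// ltW.
  by rewrite rmorphM -scalerA -scalerDr pZ ?(ltW t0)// -mulrA -mulrBr lexx.
Qed.

Lemma slide_le_self p y x : sublinear p -> slide p y x <= p x.
Proof.
move=> sp; have := slide_le y x sp (lexx 0).
by rewrite rmorph0 scale0r addr0 mul0r subr0.
Qed.

(** Zorn's lemma applies since sublinear functionals below [p] are bounded below
    by [x |-> - p (- x)], so that a chain of them has a pointwise infimum. *)
Lemma minimal_sublinear p : sublinear p ->
  exists q, [/\ sublinear q, forall x, q x <= p x &
    forall r, sublinear r -> (forall x, r x <= q x) -> r = q].
Proof.
move=> sp; pose T := {q | sublinear q /\ forall x, q x <= p x}.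
pose ge (a b : T) : bool := `[< forall x, sval b x <= sval a x >].
have [| | | |[q [sq qp]] qmin] := @Zorn T ge.
- by move=> t; apply/asboolP.
- move=> a b c /asboolP ab /asboolP bc; apply/asboolP => x.
  exact: le_trans (bc x) (ab x).
- move=> [a a'] [b b'] /asboolP /= ab /asboolP /= ba.
  apply: eq_exist => /=; apply/funext => x; apply/eqP.
  by rewrite eq_le ab ba.
- move=> A Atot.
  have [->|/set0P[a0 Aa0]] := eqVneq A set0.
    by exists (exist _ p (conj sp (fun x => lexx _))) => s.
  have lbA x : lbound [set sval a x | a in A] (- p (- x)).
    move=> _ [a Aa <-]; have [sa ap] := svalP a.
    by apply: le_trans (sublinear_oppr _ sa); rewrite lerN2.
  pose m x := inf [set sval a x | a in A].
  have mA a x : A a -> m x <= sval a x.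
    move=> Aa; apply: ge_inf; first by exists (- p (- x)).
    by exists a.
  have sm : sublinear m.
    apply: inf_sublinear => //.
    - by exists a0.
    - by move=> x; exists (- p (- x)).
    - by move=> a _; have [sa _] := svalP a; exact: sublinear0.
    - move=> a b x y Aa Ab.
      have [/asboolP ab|/asboolP ba] := Atot a b Aa Ab.
      + have [[bD _] _] := svalP b.
        by exists b => //; rewrite (le_trans (bD _ _))// lerD2r.
      + have [[aD _] _] := svalP a.
        by exists a => //; rewrite (le_trans (aD _ _))// lerD2l.
    - move=> a t x Aa t0; have [[_ aZ] _] := svalP a.
      by exists a => //; rewrite aZ// ltW.
  have mp x : m x <= p x.
    by apply: le_trans (mA _ _ Aa0) _; have [_] := svalP a0.
  by exists (exist _ m (conj sm mp)) => a Aa; apply/asboolP => x; exact: mA.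
exists q; split=> // r sr rq.
have rp x : r x <= p x by exact: le_trans (rq x) (qp x).
have := qmin (exist _ r (conj sr rp)).
by move=> H; have [] := H (asboolT rq).
Qed.

(** A minimal sublinear [q] satisfies [slide q y = q] for every [y], hence
    [q x <= q (x + y) - q y]: it is additive. Taking [q] below [slide p x0]
    rather than below [p] gives [q (- x0) <= - p x0], which is the bound at
    [x0]. *)
Lemma hahn_banach p x0 : sublinear p ->
  exists f : V -> R, [/\ forall x y, f (x + y) = f x + f y,
    forall a x, f (iota a *: x) = a * f x,
    forall x, f x <= p x & p x0 <= f x0].
Proof.
move=> sp; have [q [sq qs qmin]] := minimal_sublinear (slide_sublinear x0 sp).
have qD x y : q (x + y) = q x + q y.
  apply/eqP; rewrite eq_le sq.1/=.
  have := slide_le y x sq ler01.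
  rewrite rmorph1 scale1r mul1r (qmin _ (slide_sublinear y sq)) ?lerBrDr//.
  by move=> z; exact: slide_le_self.
have qN x : q (- x) = - q x.
  by apply/eqP; rewrite eq_sym -subr_eq0 -opprD -qD subrr (sublinear0 sq) oppr0.
exists q; split=> //.
- move=> a x; case: (leP 0 a) => [|/ltW a0]; first exact: sq.2.
  by rewrite -{1}(opprK a) rmorphN scaleNr qN sq.2 ?oppr_ge0// mulNr opprK.
- by move=> x; exact: le_trans (qs x) (slide_le_self _ _ sp).
- rewrite -lerN2 -qN (le_trans (qs _))//.
  have := slide_le x0 (- x0) sp ler01.
  by rewrite rmorph1 scale1r mul1r addNr (sublinear0 sp) sub0r.
Qed.

End HahnBanach.

(** * Bounded linear maps and norming functionals *)

Section BoundedLinear.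
Variable K : numFieldType.

Lemma bounded_operator_continuous (V W : normedModType K)
    (T : {linear V -> W}) :
  bounded_operator T -> continuous T.
Proof.
case=> M TM; apply/bounded_linear_continuous/linear_boundedP.
(* [M] is an arbitrary scalar; only its absolute value is known to be real. *)
have TM' x : `|T x| <= `|M| * `|x|.
  by rewrite -[`|x|]normr_id -normrM ger0_norm// (le_trans _ (TM x)).
near=> r => x; apply: le_trans (TM' x) _; rewrite ler_wpM2r//.
by near: r; apply: nbhs_pinfty_ge; exact: normr_real.
Unshelve. all: by end_near. Qed.

Lemma continuous_bound_gt0 (V W : normedModType K) (T : {linear V -> W}) :
  continuous T -> exists2 M : K, 0 < M & forall x, `|T x| <= M * `|x|.
Proof.
by move=> /linear_bounded_continuous/linear_boundedP/pinfty_ex_gt0[M]; exists M.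
Qed.

Lemma dual_of_bounded (V : normedModType K) (T : {linear V -> K^o}) :
  bounded_operator T -> exists phi : dual V, forall x, phi x = T x.
Proof.
move=> /bounded_operator_continuous Tc.
have Td : (T : V -> K^o) \in @dual_pred K V.
  by apply/asboolP; split=> //; exact: linearP.
by exists (Dual Td).
Qed.

Lemma dual_linear (V : normedModType K) (phi : dual V) : linear phi.
Proof. by have /asboolP[] := dual_funP phi. Qed.

Lemma dual_continuous (V : normedModType K) (phi : dual V) : continuous phi.
Proof. by have /asboolP[] := dual_funP phi. Qed.

HB.instance Definition _ (V : normedModType K) (phi : dual V) :=
  GRing.isLinear.Build K V K^o *:%R (dual_fun phi) (dual_linear phi).

End BoundedLinear.

Section Norming.
Variable R : realType.

Lemma norming_functional_real (X : normedModType R) (x : X) :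
  exists2 phi : dual X, (forall y, `|phi y| <= `|y|) & `|x| <= `|phi x|.
Proof.
have sN : sublinear (@idfun R) (fun y : X => `|y|).
  by split=> [y z|t y t0]; rewrite ?ler_normD// normrZ ger0_norm.
have [f [fD fZ fle fx]] := hahn_banach x sN.
have lf : linear (f : X -> R^o) by move=> a y z; rewrite fD fZ.
pose Tm := GRing.isLinear.Build R X R^o *:%R (f : X -> R^o) lf.
pose T : {linear X -> R^o} := HB.pack (f : X -> R^o) Tm.
have Tle y : `|T y| <= `|y|.
  by rewrite ler_norml fle andbT lerNl -(normrN y) -linearN fle.
have [|phi phiE] := dual_of_bounded (T := T).
  by exists 1 => y; rewrite mul1r.
exists phi => [y|]; rewrite phiE//.
exact: le_trans fx (ler_norm _).
Qed.

(** Bohnenblust-Sobczyk: the real-linear [f] is the real part of the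
    complex-linear [F y = f y - i f (i y)], and rotating [y] so that [F y]
    becomes real gives [|F y| <= |y|] back from [f <= |.|]. *)
Lemma norming_functional_complex (X : normedModType (R[i] : numFieldType))
    (x : X) :
  exists2 phi : dual X, (forall y, `|phi y| <= `|y|) & `|x| <= `|phi x|.
Proof.
have nE (y : X) : `|y| = (complex.Re `|y|)%:C%C.
  by rewrite RRe_real// normr_real.
have sN : sublinear (real_complex R) (fun y : X => complex.Re `|y|).
  split=> [y z|t y t0].
    by rewrite -lecR rmorphD /= -!nE ler_normD.
  by apply: (@complexI R); rewrite rmorphM /= -!nE normrZ ger0_norm ?ler0c.
have [f [fD fZ fle fx]] := hahn_banach x sN.
pose F (y : X) : R[i]^o := (f y +i* - f ('i%C *: y))%C.
have lF : linear F.
  move=> [u v] y z.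
  have fa w : f ((u +i* v)%C *: w) = u * f w + v * f ('i%C *: w).
    rewrite [(u +i* v)%C]complexE scalerDl fD fZ; congr (_ + _).
    by rewrite ['i%C * _]mulrC -scalerA fZ.
  have fN w : f (- w) = - f w.
    by rewrite -scaleN1r -(rmorphN1 (real_complex R)) fZ mulN1r.
  have FE w : F w = (f w +i* - f ('i%C *: w))%C by [].
  rewrite FE fD scalerDr scalerA [_ * (_ +i* _)%C]mulrC -scalerA fD !fa.
  rewrite scalerA -expr2 sqr_i scaleN1r fN !FE /GRing.scale/=.
  by simpc.
pose Tm := GRing.isLinear.Build R[i] X R[i]^o *:%R F lF.
pose T : {linear X -> R[i]^o} := HB.pack F Tm.
have Tle y : `|T y| <= `|y|.
  have [->|c0] := eqVneq (T y) 0; first by rewrite normr0.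
  rewrite -(ler_pM2l (_ : 0 < `|T y|)) ?normr_gt0//.
  (* Multiplying [y] by the conjugate of [T y] makes its image [|T y|^2] real,
     so that it is a value of the real part [f]. *)
  have TE : T ((T y)^*%C *: y) = `|T y| * `|T y| :> R[i].
    rewrite linearZ -expr2 -add_Re2_Im2 /GRing.scale/=.
    by simpc; rewrite [f ('i%C *: y) * f y]mulrC addNr -!expr2 sqrrN.
  have conj_norm (a : R[i]) : `|a^*%C| = `|a|.
    by rewrite !normc_def; case: a => a b /=; rewrite sqrrN.
  rewrite -TE -(RRe_real (_ : T _ \is Num.real)); last first.
    by rewrite TE rpredM// normr_real.
  by rewrite -conj_norm -normrZ nE lecR fle.
have [|phi phiE] := dual_of_bounded (T := T).
  by exists 1 => y; rewrite mul1r.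
exists phi => [y|]; rewrite phiE//.
rewrite normc_def {1}nE lecR (le_trans fx)//= (le_trans (ler_norm _))//.
by rewrite -sqrtr_sqr ler_wsqrtr// lerDl sqr_ge0.
Qed.

Lemma norming_functional k (X : normedModType (scalar_field R k)) (x : X) :
  exists2 phi : dual X, (forall y, `|phi y| <= `|y|) & `|x| <= `|phi x|.
Proof.
by case: k X x => [] X x;
  [exact: norming_functional_real|exact: norming_functional_complex].
Qed.

End Norming.

(** * The dual norm *)

Section DualNorm.
Variables (R : realType) (k : scalar_kind).
Local Notation K := (scalar_field R k).

(** The order of [R[i]] is partial, but a bounded set of nonnegative scalars
    consists of reals, and so do its upper bounds. Hence [dual_norm], a
    supremum in the scalar field, is not the default value. *)
Lemma scalar_supremums_neq0 (A : set K) (M : K) : A !=set0 ->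
  (forall a, A a -> 0 <= a <= M) -> supremums A !=set0.
Proof.
case: k A M => /= A M [a0 Aa0] AM.
  have Aub : ubound A M by move=> a /AM/andP[].
  exists (sup A); split; first by apply: ub_le_sup; exists M.
  by move=> b Ab; apply: ge_sup => //; exists a0.
have A_Re a : A a -> a = (complex.Re a)%:C%C.
  by move=> /AM/andP[/ger0_real a_real _]; rewrite RRe_real.
pose B := [set complex.Re a | a in A].
have B0 : B !=set0 by exists (complex.Re a0), a0.
have Bub : ubound B (complex.Re M).
  by move=> _ [a Aa <-]; have /andP[_] := AM _ Aa; rewrite lecE => /andP[].
exists (sup B)%:C%C; split=> [a Aa|b Ab].
  rewrite (A_Re a Aa) lecR; apply: ub_le_sup; first by exists (complex.Re M).
  by exists a.
have bE : b = (complex.Re b)%:C%C.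
  rewrite RRe_real// ger0_real// (le_trans _ (Ab _ Aa0))//.
  by have /andP[] := AM _ Aa0.
rewrite bE lecR; apply: ge_sup => // _ [a Aa <-].
by have := Ab _ Aa; rewrite lecE => /andP[].
Qed.

Variable V : normedModType K.
Implicit Type phi : dual V.

Lemma dual_norm_supremums phi :
  supremums [set `|phi x| | x in [set x : V | `|x| <= 1]] (dual_norm phi).
Proof.
have [M M0 phiM] := continuous_bound_gt0 (@dual_continuous _ _ phi).
set A := [set _ | _ in _].
have A0 : A 0 by exists 0; rewrite /= ?normr0// linear0 normr0.
have : supremums A !=set0.
  apply: (@scalar_supremums_neq0 _ M); first by exists 0.
  move=> _ [x /= x1 <-]; rewrite normr_ge0/=.
  by apply: le_trans (phiM x) _; rewrite ler_piMr// ltW.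
rewrite /dual_norm /supremum -/A; case: ifPn => [/eqP A_eq|_ [m]].
  by move: A0; rewrite A_eq.
exact: xgetI.
Qed.

Lemma dual_norm_ge0 phi : 0 <= dual_norm phi.
Proof.
have [ub _] := dual_norm_supremums phi.
by apply: ub; exists 0; rewrite /= ?normr0// linear0 normr0.
Qed.

Lemma le_dual_norm phi x : `|phi x| <= dual_norm phi * `|x|.
Proof.
have [->|x0] := eqVneq x 0; first by rewrite linear0 !normr0 mulr0.
have nx0 : 0 < `|x| by rewrite normr_gt0.
have [ub _] := dual_norm_supremums phi.
rewrite -ler_pdivrMr// mulrC; apply: ub; exists (`|x|^-1 *: x) => /=.
  by rewrite normrZ normfV normr_id mulVf ?gt_eqF.
by rewrite linearZ normrM normfV normr_id.
Qed.

Lemma dual_norm_le phi M : 0 <= M -> (forall x, `|phi x| <= M * `|x|) ->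
  dual_norm phi <= M.
Proof.
move=> M0 phiM; have [_ lub] := dual_norm_supremums phi.
apply: lub => _ [x /= x1 <-]; apply: le_trans (phiM x) _.
by rewrite ler_piMr.
Qed.

End DualNorm.

(** * Series along a basis and the analysis operator *)

Section SeriesLimits.
Variable K : numFieldType.

Lemma cvg_norm_le (V W : normedModType K) (u : nat -> V) (v : nat -> W)
    (x : V) (y : W) (M : K) : 0 < M ->
  u @ \oo --> x -> v @ \oo --> y -> (forall n, `|u n| <= M * `|v n|) ->
  `|x| <= M * `|y|.
Proof.
move=> M0 ux vy uv; apply/ler_addgt0Pr => e e0.
have e20 : 0 < e / 2 by rewrite divr_gt0.
near \oo => n.
have xu : `|x - u n| <= e / 2.
  by near: n; apply: (cvgr_dist_le _ _ ux).
have yv : `|y - v n| <= M^-1 * (e / 2).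
  by near: n; apply: (cvgr_dist_le _ _ vy); rewrite mulr_gt0// invr_gt0.
rewrite -(subrK (u n) x) (le_trans (ler_normD _ _))//.
rewrite (splitr e) addrCA lerD// (le_trans (uv n))//.
rewrite -ler_pdivlMl// mulrDr mulKf ?gt_eqF//.
by rewrite -{1}(subKr y (v n)) (le_trans (ler_normB _ _))// lerD2l.
Unshelve. all: by end_near. Qed.

Lemma series_linear (V W : lmodType K) (T : {linear V -> W}) (c : nat -> K)
    (e : nat -> V) :
  T \o series (fun i => c i *: e i) = series (fun i => c i *: T (e i)).
Proof.
apply/funext => n; rewrite /series /= linear_sum.
by apply: eq_bigr => i _; rewrite linearZ_LR.
Qed.

Lemma cvg_series_linear (V W : normedModType K) (T : {linear V -> W})
    (c : nat -> K) (e : nat -> V) x : continuous T ->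
  series (fun i => c i *: e i) @ \oo --> x ->
  series (fun i => c i *: T (e i)) @ \oo --> T x.
Proof.
by move=> Tc ex; rewrite -series_linear; apply: cvg_comp ex _; exact: Tc.
Qed.

Lemma cvg_series_delta (Xd : cb_space K) (V : normedModType K)
    (e : nat -> V) i :
  series (fun j => entries (delta Xd i) j *: e j) @ \oo --> e i.
Proof.
apply: cvg_near_cst; exists i.+1 => // n /= lt_in.
rewrite /series /= delta_entries big_mkord (bigD1 (Ordinal lt_in))//= eqxx.
rewrite scale1r big1 ?addr0// => j ji.
rewrite (_ : (j == i :> nat) = false) ?scale0r//.
by apply/negbTE; apply: contra ji => /eqP ji; apply/eqP/val_inj.
Qed.

Lemma eq_on_delta (Xd : cb_space K) (V : normedModType K)
    (S T : {linear Xd -> V}) : continuous S -> continuous T ->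
  (forall i, S (delta Xd i) = T (delta Xd i)) -> forall c, S c = T c.
Proof.
move=> Sc Tc ST c; have cE := @delta_expansion _ _ c.
have Sx := cvg_series_linear Sc cE; have Tx := cvg_series_linear Tc cE.
rewrite -(cvg_lim (@norm_hausdorff _ V) Sx) -(cvg_lim (@norm_hausdorff _ V) Tx).
by congr (limn (series _)); apply/funext => i; rewrite ST.
Qed.

End SeriesLimits.

Section Analysis.
Variables (K : numFieldType) (Xd : cb_space K) (X : normedModType K).
Variables (U : X -> Xd) (g : nat -> dual X).
Hypothesis UE : forall f, entries (U f) = (fun i => g i f).

Lemma cvg_series_analysis f :
  series (fun i => g i f *: delta Xd i) @ \oo --> U f.
Proof. by have := @delta_expansion _ _ (U f); rewrite UE. Qed.

Hypothesis gframe : Xd_frame Xd g.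

Lemma analysis_bounded : exists2 B, 0 < B & forall f, `|U f| <= B * `|f|.
Proof.
have [_ [A [B [_ B0 AB]]]] := gframe; exists B => // f.
by have /andP[] := AB f (U f) (UE f).
Qed.

Lemma analysis_inj : injective U.
Proof.
have [_ [A [B [A0 _ AB]]]] := gframe; move=> x y Uxy.
have /andP[+ _] : A * `|x - y| <= `|U x - U y| <= B * `|x - y|.
  apply: AB; rewrite raddfB/= !UE; apply/funext => i.
  by rewrite linearB.
by rewrite Uxy subrr normr0 pmulr_rle0// normr_le0 subr_eq0 => /eqP.
Qed.

End Analysis.

(** * Synthesis operators *)

Section Synthesis.
Variables (R : realType) (k : scalar_kind).
Local Notation K := (scalar_field R k).
Variables (X : completeNormedModType K) (Xd : cb_space K).

(** Testing [sum c_i f_i] against a functional that attains its norm moves the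
    estimate into [Xd^*], where it is the upper frame bound. *)
Lemma dual_Xd_frame_combination_le (f_ : nat -> X) : dual_Xd_frame Xd f_ ->
  exists2 B : K, 0 < B & forall (c : nat -> K) m n,
    `|\sum_(m <= i < n) c i *: f_ i| <=
      B * `|\sum_(m <= i < n) c i *: delta Xd i|.
Proof.
move=> [f_dual [A [B [A0 B0 AB]]]]; exists B => // c m n.
set x := \sum_(m <= i < n) c i *: f_ i; set s := \sum_(m <= i < n) _.
have [phi phi_le phi_x] := norming_functional x.
have [V Vf] := f_dual phi.
have phixE : phi x = V s.
  rewrite !linear_sum; apply: eq_bigr => i _.
  by rewrite !linearZ_LR /= Vf.
apply: le_trans phi_x _; rewrite phixE (le_trans (le_dual_norm _ _))//.
rewrite ler_wpM2r//; have /andP[_ /le_trans->//] := AB phi V Vf.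
rewrite -[leRHS]mulr1 ler_wpM2l ?(ltW B0)// dual_norm_le// => y.
by rewrite mul1r.
Qed.

Lemma cvg_synthesis_linear (f_ : nat -> X) a (c d : Xd) x y :
  series (fun i => entries c i *: f_ i) @ \oo --> x ->
  series (fun i => entries d i *: f_ i) @ \oo --> y ->
  series (fun i => entries (a *: c + d) i *: f_ i) @ \oo --> a *: x + y.
Proof.
move=> cx dy; rewrite (_ : series _ = fun n =>
  a *: series (fun i => entries c i *: f_ i) n +
  series (fun i => entries d i *: f_ i) n); last first.
  apply/funext => n; rewrite /series /= scaler_sumr -big_split/=.
  by apply: eq_bigr => i _; rewrite linearP scalerDl scalerA.
by apply: cvgD dy; exact: cvgZl_tmp cx.
Qed.

Lemma synthesis_operator (f_ : nat -> X) : dual_Xd_frame Xd f_ ->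
  exists2 L : {linear Xd -> X}, bounded_operator L &
    forall c, series (fun i => entries c i *: f_ i) @ \oo --> L c.
Proof.
move=> /dual_Xd_frame_combination_le[B B0 fB].
pose S (c : Xd) := series (fun i => entries c i *: f_ i).
have Scvg c : S c @ \oo --> limn (S c).
  apply/cauchy_cvgP/cauchy_seriesP => e e0.
  have : cauchy (series (fun i => entries c i *: delta Xd i) @ \oo).
    by apply: cvg_cauchy; apply/cvg_ex; exists c; exact: delta_expansion.
  move=> /cauchy_seriesP/(_ (B^-1 * e)).
  rewrite mulr_gt0 ?invr_gt0// => /(_ isT).
  apply: filterS => -[m n] /= mn.
  by rewrite (le_lt_trans (fB _ _ _))// -ltr_pdivlMl.
have Llin : linear (fun c => limn (S c)).
  move=> a c d; apply: cvg_lim; first exact: norm_hausdorff.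
  exact: cvg_synthesis_linear (Scvg c) (Scvg d).
pose Lm := GRing.isLinear.Build K Xd X *:%R (fun c => limn (S c)) Llin.
pose L : {linear Xd -> X} := HB.pack (fun c => limn (S c)) Lm.
exists L => //; exists B => c.
apply: cvg_norm_le B0 (Scvg c) (@delta_expansion _ _ c) _ => n.
exact: fB.
Qed.

Lemma s_pseudo_dual_operator (U : X -> Xd) (g : nat -> dual X)
    (L : {linear Xd -> X}) :
  (forall f, entries (U f) = (fun i => g i f)) -> continuous L ->
  cancel U L -> s_pseudo_dual g (fun i => L (delta Xd i)).
Proof.
move=> UE Lc UL f.
have := cvg_series_linear Lc (@cvg_series_analysis _ _ _ _ _ UE f).
by rewrite UL.
Qed.

(** The functional on [Xd] with coordinates [phi (L delta_i)] can only be
    [phi o L]. The upper bound is then that of [L], and the lower one comes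
    from [phi = phi o L o U] and the bound of [U]. *)
Lemma dual_Xd_frame_operator (U : X -> Xd) (B : K) (L : {linear Xd -> X}) :
  0 < B -> (forall f, `|U f| <= B * `|f|) ->
  continuous L -> cancel U L -> dual_Xd_frame Xd (fun i => L (delta Xd i)).
Proof.
move=> B0 UB Lc UL.
have comp_cont (phi : dual X) : continuous (phi \o L).
  by move=> c; apply: continuous_comp; [exact: Lc|exact: dual_continuous].
have [M M0 LM] := continuous_bound_gt0 Lc.
split=> [phi|].
  have [N _ phiN] := continuous_bound_gt0 (comp_cont phi).
  have [|V VE] := @dual_of_bounded K _ (phi \o L); first by exists N.
  by exists V => i; rewrite VE.
exists B^-1, M; split=> // [|phi V Vf]; first by rewrite invr_gt0.
have VE c : V c = phi (L c).
  apply: (@eq_on_delta _ _ _ V (phi \o L) _ (comp_cont phi) Vf).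
  exact: dual_continuous.
apply/andP; split.
  rewrite ler_pdivrMl//; apply: dual_norm_le => [|f].
    by rewrite mulr_ge0 ?dual_norm_ge0// ltW.
  rewrite -{1}(UL f) -VE (le_trans (le_dual_norm _ _))//.
  by rewrite -mulrA mulrCA ler_wpM2l ?dual_norm_ge0.
apply: dual_norm_le => [|c]; first by rewrite mulr_ge0 ?dual_norm_ge0// ltW.
rewrite VE (le_trans (le_dual_norm _ _))// mulrAC.
by rewrite [leRHS]mulrC ler_wpM2l ?dual_norm_ge0.
Qed.

Lemma synthesis_partial_operator (f_ : nat -> X) :
  exists L : partial_operator Xd X,
    op_dom L = [set c | cvg (series (fun i => entries c i *: f_ i) @ \oo)] /\
    forall c, L c = limn (series (fun i => entries c i *: f_ i)).
Proof.
pose S (c : Xd) := series (fun i => entries c i *: f_ i).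
have S0 : cvg (S 0 @ \oo).
  apply/cvg_ex; exists 0; rewrite (_ : S 0 = fun=> 0); first exact: cvg_cst.
  apply/funext => n; rewrite /S /series /= big1// => i _.
  by rewrite linear0 scale0r.
unshelve eexists (@PartialOperator K Xd X [set c | cvg (S c @ \oo)]
  (fun c => limn (S c)) S0 _ _).
- by move=> a c d Sc Sd; apply/cvg_ex; eexists; exact: cvg_synthesis_linear Sc Sd.
- move=> a c d Sc Sd; apply: cvg_lim; first exact: norm_hausdorff.
  exact: cvg_synthesis_linear Sc Sd.
- by [].
Qed.

Lemma op_dom_sum (L : partial_operator Xd X) (e : nat -> Xd) (c : nat -> K) n :
  (forall i, op_dom L (e i)) -> op_dom L (\sum_(i < n) c i *: e i).
Proof.
move=> Le; elim: n => [|n dom_n]; first by rewrite big_ord0; exact: op_dom0.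
by rewrite big_ord_recr/= addrC; exact: op_dom_linear.
Qed.

Lemma partial_operator_series (L : partial_operator Xd X) (e : nat -> Xd)
    (c : nat -> K) : (forall i, op_dom L (e i)) ->
  L \o series (fun i => c i *: e i) = series (fun i => c i *: L (e i)).
Proof.
move=> Le; apply/funext => n; rewrite /series /= !big_mkord.
elim: n => [|n IHn].
  rewrite !big_ord0; have := op_fun_linear 1 (op_dom0 L) (op_dom0 L).
  by rewrite !scale1r addr0 => /eqP; rewrite -subr_eq subrr eq_sym => /eqP.
rewrite !big_ord_recr/= !(addrC _ (c n *: _)) op_fun_linear ?IHn//.
exact: op_dom_sum.
Qed.

End Synthesis.

(** * Duals of a frame *)

Theorem theorem4p2 (R : realType) (k : scalar_kind)
    (X : completeNormedModType (scalar_field R k))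
    (Xinf : ~ finite_dimensional X) (Xsep : separable X)
    (Xd : rcb_space (scalar_field R k))
    (g : nat -> dual X) (gframe : Xd_frame Xd g)
    (U : X -> Xd) (UE : forall f : X, entries (U f) = (fun i => g i f)) :
  let Uinv : Xd -> X := 'pinv_(fun=> 0) [set: X] U in
  ((exists f_ : nat -> X, dual_frame_of Xd g f_) ->
    forall f_ : nat -> X, dual_frame_of Xd g f_ <->
      exists L : {linear Xd -> X},
        [/\ bounded_operator L,
            (forall c : Xd, range U c -> L c = Uinv c) &
            f_ = (fun i => L (delta Xd i))]) /\
  ((exists f_ : nat -> X, s_pseudo_dual g f_) ->
    forall f_ : nat -> X, s_pseudo_dual g f_ <->
      exists L : partial_operator Xd X,
        [/\ linear_span (delta Xd) `<=` op_dom L,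
            range U `<=` op_dom L,
            (forall f : X,
              L \o series (fun i => g i f *: delta Xd i) @ \oo -->
              L (limn (series (fun i => g i f *: delta Xd i)))),
            (forall f : X, L (U f) = f) &
            f_ = (fun i => L (delta Xd i))]).
Proof.
move=> Uinv.
have UinvK f : Uinv (U f) = f.
  by apply: pinvKV; rewrite ?inE// => x y _ _; exact: analysis_inj UE gframe _ _.
have [B B0 UB] := analysis_bounded UE gframe.
have limU f : limn (series (fun i => g i f *: delta Xd i)) = U f.
  by apply: cvg_lim; [exact: norm_hausdorff|exact: cvg_series_analysis].
have delta_span i : linear_span (delta Xd) (delta Xd i).
  exists i.+1, (fun j => (j == i)%:R); rewrite big_ord_recr/= eqxx scale1r.
  by rewrite big1 ?add0r// => j _; rewrite ltn_eqF ?scale0r.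
split=> _ f_; split.
- move=> [f_pd f_dual]; have [L Lb Lf] := synthesis_operator f_dual.
  exists L; split=> //.
    move=> _ [f _ <-]; rewrite UinvK.
    apply: (cvg_unique (@norm_hausdorff _ X) (Lf _)) => /=.
    by rewrite UE; exact: f_pd.
  apply/funext => i.
  have f_lim := @cvg_series_delta _ Xd _ f_ i.
  exact: (cvg_unique (@norm_hausdorff _ X) f_lim (Lf _)).
- move=> [L [Lb LU ->]]; have Lc := bounded_operator_continuous Lb.
  have LK : cancel U L by move=> f; rewrite LU// UinvK.
  split; first exact: s_pseudo_dual_operator UE Lc LK.
  exact: dual_Xd_frame_operator B0 UB Lc LK.
- move=> f_pd; have [L [domL LE]] := synthesis_partial_operator Xd f_.
  have Ldelta i : L (delta Xd i) = f_ i.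
    rewrite LE; apply: cvg_lim; first exact: norm_hausdorff.
    exact: cvg_series_delta.
  have delta_dom i : op_dom L (delta Xd i).
    by rewrite domL; apply/cvg_ex; exists (f_ i); exact: cvg_series_delta.
  have LU f : L (U f) = f.
    by rewrite LE UE; apply: cvg_lim; [exact: norm_hausdorff|exact: f_pd].
  exists L; split=> //.
  + by move=> _ [n [c ->]]; exact: op_dom_sum.
  + by move=> _ [f _ <-]; rewrite domL /= UE; apply/cvg_ex; exists f; exact: f_pd.
  + move=> f; rewrite limU LU partial_operator_series//.
    by under eq_fun do rewrite Ldelta; exact: f_pd.
  + by apply/funext => i; rewrite Ldelta.
- move=> [L [spanL _ LU LK ->]] f.
  rewrite -partial_operator_series => [|i]; last exact: spanL.
  by have := LU f; rewrite limU LK.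
Qed.
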